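(* $(\mathbb{E},\star,[\mathsf{emp}])$ is a commutative monoid: for all $X,Y,Z\in\mathbb{E}$, (1) $X\star(Y\star Z)=(X\star Y)\star Z$; (2) $X\star[\mathsf{emp}]=[\mathsf{emp}]\star X=X$; (3) $X\star Y=Y\star X$.
   Context: States are pairs $(s,h)$ of a stack $s:\mathrm{Vars}\to\mathbb{Z}$ and a heap $h$, i.e. a map $h:N\to\mathbb{Z}$ with $N=\mathrm{dom}(h)\subseteq\mathbb{N}_{>0}$ finite; $\Sigma$ is the set of states. Heaps are disjoint if their domains are; $h_1\star h_2$ is the union of disjoint heaps. $\mathbb{E}$ is the set of functions $\Sigma\to\mathbb{R}_{\ge0}\cup\{\infty\}$ (expectations), with $0\cdot\infty=0$. The quantitative separating conjunction is $(X\star Y)(s,h)=\max\{X(s,h_1)\cdot Y(s,h_2)\mid h=h_1\star h_2\}$. $[\mathsf{emp}](s,h)=1$ if $\mathrm{dom}(h)=\emptyset$ and $0$ otherwise. *)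

(* Defs.v *)
From HB Require Import structures.
From mathcomp Require Import all_boot all_order all_algebra finmap.
From mathcomp Require Import interval_inference boolp classical_sets reals.
From mathcomp Require Import constructive_ereal.

Set Implicit Arguments.
Unset Strict Implicit.
Unset Printing Implicit Defensive.

Import Order.TTheory GRing.Theory Num.Theory.

Local Open Scope classical_set_scope.
Local Open Scope ring_scope.
Local Open Scope ereal_scope.

Definition loc := {n : nat | (0 < n)%N}.

Definition heap := {fmap loc -> int}.

Definition stack (Vars : Type) := Vars -> int.

Definition state (Vars : Type) := (stack Vars * heap)%type.

(* [{nonneg \bar R}] contains [+oo], and [mule] satisfies [0 * +oo = 0]. *)
Definition expectation (R : realType) (Vars : Type) :=
  state Vars -> {nonneg \bar R}.

Definition nnmule (R : realType) (x y : {nonneg \bar R}) : {nonneg \bar R} :=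
  (x%:num * y%:num)%:nng.

Definition heap_disjoint (h1 h2 : heap) : bool :=
  [disjoint domf h1 & domf h2]%fset.

(* The partial operation of heaps: [catf] is the union of maps only when the
   domains are disjoint. *)
Definition heap_split (h h1 h2 : heap) : Prop :=
  heap_disjoint h1 h2 /\ h = (h1 + h2)%fset.

Definition is_max (R : realType) (A : set {nonneg \bar R})
    (m : {nonneg \bar R}) : Prop :=
  A m /\ forall x, A x -> x%:num <= m%:num.

(* The default value 0 is irrelevant in [sepcon]: see [sepcon_is_max]. *)
Definition set_max (R : realType) (A : set {nonneg \bar R}) :
    {nonneg \bar R} :=
  xget (0%:E)%:nng (is_max A).

Definition sepcon_values (R : realType) (Vars : Type)
    (X Y : expectation R Vars) (s : stack Vars) (h : heap) :
    set {nonneg \bar R} :=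
  [set v | exists h1 h2 : heap, heap_split h h1 h2 /\
    v = nnmule (X (s, h1)) (Y (s, h2))].

Definition sepcon (R : realType) (Vars : Type) (X Y : expectation R Vars) :
    expectation R Vars :=
  fun sh => set_max (sepcon_values X Y sh.1 sh.2).

Definition emp (R : realType) (Vars : Type) : expectation R Vars :=
  fun sh => if domf sh.2 == fset0 then (1%:E)%:nng else (0%:E)%:nng.

Arguments emp {R Vars}.

Lemma heap_split_restrict (h h1 h2 : heap) : heap_split h h1 h2 ->
  h1 = h.[& domf h1]%fmap /\ h2 = h.[\ domf h1]%fmap.
Proof.
move=> [d ->]; split; apply/fmapP => k.
  rewrite fnd_restrict fnd_cat; case: ifPn => [k1|k1].
    by rewrite (negbTE (fdisjointP d _ k1)).
  by rewrite not_fnd.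
rewrite fnd_rem fnd_cat; case: ifPn => [k1|k1].
  by rewrite not_fnd // (fdisjointP d _ k1).
by case: ifPn => // k2; rewrite !not_fnd.
Qed.

Lemma restrict_heap_split (h : heap) (A : {fset loc}) :
  heap_split h h.[& A]%fmap h.[\ A]%fmap.
Proof.
split.
  by apply/fdisjointP => k; rewrite mem_restrictf mem_remf => /andP[-> _].
apply/fmapP => k; rewrite fnd_cat mem_remf fnd_rem fnd_restrict.
by case: (k \in A) => //=; case: ifPn => // /not_fnd ->.
Qed.

Lemma seq_max (R : realType) (T : eqType) (f : T -> \bar R) (s : seq T)
    (x0 : T) : x0 \in s -> exists m, forall x, x \in s -> f x <= f m.
Proof.
elim: s x0 => // a s IH _ _; case: s IH => [|b s] IH.
  by exists a => x; rewrite inE => /eqP->.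
have [m mmax] := IH b (mem_head b s).
have [am|ma] := leP (f a) (f m).
  by exists m => x; rewrite inE => /orP[/eqP->|/mmax].
exists a => x; rewrite inE => /orP[/eqP->//|/mmax xm].
exact: le_trans xm (ltW ma).
Qed.

Lemma sepcon_is_max (R : realType) (Vars : Type) (X Y : expectation R Vars)
    (s : stack Vars) (h : heap) :
  is_max (sepcon_values X Y s h) (sepcon X Y (s, h)).
Proof.
rewrite /sepcon /set_max /=; apply: xgetPex.
pose f (A : {fset loc}) : {nonneg \bar R} :=
  nnmule (X (s, h.[& A]%fmap)) (Y (s, h.[\ A]%fmap)).
have [A Amax] : exists A, forall B, B \in enum_fset (fpowerset (domf h)) ->
    (f B)%:num <= (f A)%:num.
  apply: (@seq_max R _ (fun A => (f A)%:num) _ fset0).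
  by have : fset0 \in fpowerset (domf h) by rewrite fpowersetE fsub0set.
exists (f A); split.
  exists h.[& A]%fmap, h.[\ A]%fmap; split => //; exact: restrict_heap_split.
move=> _ [h1 [h2 [hs ->]]].
have [e1 e2] := heap_split_restrict hs.
have -> : nnmule (X (s, h1)) (Y (s, h2)) = f (domf h1).
  by rewrite /f -e1 -e2.
apply: Amax.
have : domf h1 \in fpowerset (domf h); last by [].
rewrite fpowersetE; apply/fsubsetP => k k1.
by rewrite (proj2 hs) mem_catf k1.
Qed.

(* Main.v *)
(** Every value of [X * Y] is attained at some splitting of the heap, so an
inequality between separating conjunctions amounts to re-associating or swapping
a splitting and using monotonicity of the product. Associativity needs only one
of its two inequalities: the other one follows from it by commutativity. *)

Require Import Defs.
From mathcomp Require Import all_boot all_order all_algebra reals.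
From mathcomp Require Import finmap interval_inference boolp.
From mathcomp Require Import constructive_ereal.

Set Implicit Arguments.
Unset Strict Implicit.
Unset Printing Implicit Defensive.

Import Order.TTheory.

(** The union [+] of finite maps favours its right argument, so the swap rests on disjointness: no
    location lies in both domains. *)
Lemma heap_splitC (h h1 h2 : heap) : heap_split h h1 h2 -> heap_split h h2 h1.
Proof.
move=> [d ->]; split; first by rewrite /heap_disjoint fdisjoint_sym.
apply/fmapP => k; rewrite !fnd_cat; case: ifPn => k2; case: ifPn => k1 //.
  by rewrite (negbTE (fdisjointP d _ k1)) in k2.
by rewrite !not_fnd.
Qed.

(** The first resulting splitting serves the inner conjunction after regrouping, the second the
    outer one. *)
Lemma heap_splitA (h h1 h23 h2 h3 : heap) :
  heap_split h h1 h23 -> heap_split h23 h2 h3 ->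
  heap_split (h1 + h2)%fset h1 h2 /\ heap_split h (h1 + h2)%fset h3.
Proof.
move=> [d1 ->] [d2 e]; move: d1; rewrite {}e /heap_disjoint => /fdisjointP d1.
split; split; rewrite /heap_disjoint.
- apply/fdisjointP => k /d1; rewrite mem_catf negb_or.
  by case/andP.
- by [].
- apply/fdisjointP => k; rewrite mem_catf => /orP[/d1|].
    by rewrite mem_catf negb_or => /andP[].
  exact: (fdisjointP d2).
- apply/fmapP => k; rewrite !fnd_cat mem_catf.
  by case: (k \in domf h3); rewrite ?orbT ?orbF.
Qed.

Lemma heap_split_dom0 (h h1 h2 : heap) :
  heap_split h h1 h2 -> domf h2 = fset0 -> h1 = h.
Proof.
move=> [_ ->] e; apply/fmapP => k; rewrite fnd_cat.
by case: ifPn => // k2; rewrite e in_fset0 in k2.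
Qed.

Lemma heap_split_fmap0 (h : heap) : heap_split h h [fmap]%fmap.
Proof.
split; first by rewrite /heap_disjoint fdisjointX0.
by apply/fmapP => k; rewrite fnd_cat in_fset0.
Qed.

Section SepconMonoid.
Local Open Scope ring_scope.
Local Open Scope ereal_scope.
Variables (R : realType) (Vars : Type).
Implicit Types (X Y Z : expectation R Vars) (s : stack Vars) (h : heap).

Lemma expectation_eq X Y :
  (forall s h, (X (s, h))%:num = (Y (s, h))%:num) -> X = Y.
Proof. by move=> e; apply/funext => -[s h]; apply/val_inj/e. Qed.

(** With [sepcon_attained], this is the only access to the maximum in what follows. *)
Lemma sepcon_ge X Y s h h1 h2 : heap_split h h1 h2 ->
  (X (s, h1))%:num * (Y (s, h2))%:num <= (sepcon X Y (s, h))%:num.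
Proof.
move=> hs; have [_ /(_ (nnmule (X (s, h1)) (Y (s, h2))))] :=
  sepcon_is_max X Y s h.
by apply; exists h1, h2.
Qed.

Lemma sepcon_attained X Y s h : exists h1 h2, heap_split h h1 h2 /\
  (sepcon X Y (s, h))%:num = (X (s, h1))%:num * (Y (s, h2))%:num.
Proof.
have [[h1 [h2 [hs ->]]] _] := sepcon_is_max X Y s h.
by exists h1, h2.
Qed.

Lemma sepcon_leC X Y s h :
  (sepcon X Y (s, h))%:num <= (sepcon Y X (s, h))%:num.
Proof.
have [h1 [h2 [hs ->]]] := sepcon_attained X Y s h.
by rewrite muleC; apply/sepcon_ge/heap_splitC.
Qed.

Lemma sepconC X Y : sepcon X Y = sepcon Y X.
Proof. by apply: expectation_eq => s h; apply/le_anti; rewrite !sepcon_leC. Qed.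

Lemma sepcon_leA X Y Z s h :
  (sepcon X (sepcon Y Z) (s, h))%:num <= (sepcon (sepcon X Y) Z (s, h))%:num.
Proof.
have [h1 [h23 [hs ->]]] := sepcon_attained X (sepcon Y Z) s h.
have [h2 [h3 [hs' ->]]] := sepcon_attained Y Z s h23.
have [hs12 hs3] := heap_splitA hs hs'.
rewrite muleA; apply: le_trans (sepcon_ge _ _ _ hs3).
(* The common factor is a value of [Z]: it may be [+oo], but it is nonnegative, which is enough for
   monotonicity. *)
by apply: lee_wpmul2r => //; apply: sepcon_ge.
Qed.

Lemma sepconA X Y Z : sepcon X (sepcon Y Z) = sepcon (sepcon X Y) Z.
Proof.
apply: expectation_eq => s h; apply/le_anti; rewrite sepcon_leA /=.
(* Reversing the order of the three factors turns the remaining inequality into [sepcon_leA] for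
   [Z], [Y], [X]. *)
rewrite (sepconC (sepcon X Y) Z) (sepconC X Y)
  (sepconC X (sepcon Y Z)) (sepconC Y Z).
exact: sepcon_leA.
Qed.

Lemma sepcon_emp X : sepcon X emp = X.
Proof.
apply: expectation_eq => s h; apply/le_anti/andP; split; last first.
  by have := sepcon_ge X emp s (heap_split_fmap0 h); rewrite /emp eqxx mule1.
have [h1 [h2 [hs ->]]] := sepcon_attained X emp s h.
(* If [h2] is nonempty, the product is 0 even where [X] is [+oo], by the convention for [mule], and
   0 is below any value of [X]. *)
rewrite /emp /=; case: eqP => [/(heap_split_dom0 hs)->|_].
  by rewrite mule1.
by rewrite mule0.
Qed.

End SepconMonoid.

Theorem theorem3p5 (R : realType) (Vars : Type) :
  (forall X Y Z : expectation R Vars,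
     sepcon X (sepcon Y Z) = sepcon (sepcon X Y) Z) /\
  (forall X : expectation R Vars, sepcon X emp = X /\ sepcon emp X = X) /\
  (forall X Y : expectation R Vars, sepcon X Y = sepcon Y X).
Proof.
split; first exact: sepconA.
split; last exact: sepconC.
by move=> X; rewrite (sepconC emp) sepcon_emp.
Qed.
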